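(* Let $K$ be a field, $R=K[\lambda]$, $M=R^n$, let $A=A(\lambda)$ be an $n\times n$ matrix over $R$ with $\Delta(\lambda)=\det[A(\lambda)]$ not identically zero, let $p=p(\lambda)\in R$ be a monic irreducible factor of $\Delta$, let $s=\deg p$, and let $\mu\ge 1$ be the integer with $\Delta=f p^\mu$, $p\nmid f$. Run the local Smith form algorithm described in the context on input $(A,p)$. Then the algorithm terminates (the body of its while loop is never executed with $k>\mu$), and on termination the matrix $V(\lambda)=[x_1(\lambda),\dots,x_n(\lambda)]$ and the integers $\alpha_1,\dots,\alpha_n$ that it produces satisfy: (i) $V(\lambda)$ is unimodular; (ii) $0\le\alpha_1\le\cdots\le\alpha_n$, and there is an $n\times n$ matrix polynomial $E(\lambda)$ over $K$ with $$A(\lambda)V(\lambda)=E(\lambda)D(\lambda),\qquad D(\lambda)=\operatorname{diag}[p(\lambda)^{\alpha_1},\dots,p(\lambda)^{\alpha_n}],\qquad p(\lambda)\nmid\det[E(\lambda)];$$ (iii) $\deg x_m\le\max(s\alpha_m-1,0)$ for $1\le m\le n$.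
   Context: A square matrix polynomial over $K$ is called unimodular if its determinant is a nonzero constant in $K$. The degree of a vector polynomial is the maximum of the degrees of its components. For polynomials, $g=\operatorname{quo}(f,p)$ and $r=\operatorname{rem}(f,p)$ denote quotient and remainder: $f=gp+r$, $\deg r<\deg p$; both are applied componentwise to vectors. Since $p$ is irreducible, $R/pR$ is a field and $M/pM$ is a vector space over it; for $y\in M$, $\dot y=y+pM\in M/pM$, and for $a\in R$, $\dot a=a+pR$. The local Smith form algorithm: 1. Initialize $k=0$, $i=1$, $V=[x_1,\dots,x_n]=I_{n\times n}$. 2. While $i\le n$: set $r_{k-1}=n+1-i$, and repeat the following steps (a)-(b) exactly $r_{k-1}$ times, then replace $k$ by $k+1$. (a) Set $y_i=\operatorname{rem}(\operatorname{quo}(Ax_i,p^k),p)$. (b) If $\{\dot y_1,\dots,\dot y_i\}$ is linearly independent in $M/pM$ over $R/pR$, set $\alpha_i=k$ and replace $i$ by $i+1$ (column $x_i$ is accepted). Otherwise, find $\dot a_1,\dots,\dot a_{i-1}\in R/pR$ with $\dot y_i-\sum_{m=1}^{i-1}\dot a_m\dot y_m=\dot 0$, let $a_m\in R$ be the unique representative of $\dot a_m$ with $\deg a_m<s$, replace $x_i$ by $x_i-\sum_{m=1}^{i-1}p^{k-\alpha_m}a_mx_m$, and then cyclically rotate this new $x_i$ to the end: $x_{\mathrm{tmp}}=x_i$, $x_m=x_{m+1}$ for $m=i,\dots,n-1$, $x_n=x_{\mathrm{tmp}}$ (with $i$ unchanged). 3. Output $V=[x_1,\dots,x_n]$ and $\alpha_1,\dots,\alpha_n$.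 *)

(* Defs.v *)
From mathcomp Require Import all_boot all_order all_algebra all_field.

Set Implicit Arguments.
Unset Strict Implicit.
Unset Printing Implicit Defensive.

Import GRing.Theory.
Local Open Scope ring_scope.

Definition unimodular (K : fieldType) (n : nat) (V : 'M[{poly K}]_n) : Prop :=
  exists2 c : K, c != 0 & \det V = c%:P.

(* The zero component is given degree 0 instead of -oo. *)
Definition vdeg (K : fieldType) (n : nat) (x : 'cV[{poly K}]_n) : nat :=
  (\max_(r < n) (size (x r 0%R)).-1)%N.

Section LocalSmithForm.

Variables (K : fieldType) (n : nat) (A : 'M[{poly K}]_n).
Variables (p : {poly K}) (p_mi : monic_irreducible_poly p).

(* The field R/pR. Its elements are stored as their unique representatives of *)
(* degree < deg p, which [val] returns.                                       *)
Local Notation F := {poly %/ p with p_mi}.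

(* M/pM is identified with (R/pR)^n, the class y + pM being the vector of the *)
(* classes of the components of y.                                            *)
Definition residue (y : 'cV[{poly K}]_n) : 'cV[F]_n :=
  map_mx (in_qpoly p : {poly K} -> F) y.

(* Indices start from 0: the variable i of the pseudocode is [st_i].+1, so    *)
(* that [st_i] is the number of accepted columns and the loop guard i <= n    *)
(* reads [st_i < n]. Only the values of [st_x] below n, and those of [st_y]   *)
(* and [st_alpha] that have already been assigned, are ever used.             *)
Record lsf_state := LsfState {
  st_k : nat;
  st_i : nat;
  st_x : nat -> 'cV[{poly K}]_n;
  st_y : nat -> 'cV[{poly K}]_n;
  st_alpha : nat -> nat
}.

Definition lsf_init : lsf_state :=
  LsfState 0 0 (fun m => \col_(r < n) (r == m :> nat)%:R)
           (fun=> 0) (fun=> 0%N).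

(* Steps (a) and (b). In the second branch the coefficients are provided by   *)
(* [coord]; they are the only possible ones, since the residues of the        *)
(* accepted y_m are linearly independent over F. The subtraction k - alpha_m  *)
(* is never truncated, as k does not decrease.                                *)
Definition lsf_step (st : lsf_state) : lsf_state :=
  let: LsfState k i x y alpha := st in
  let yi := map_mx (fun f => (f %/ p ^+ k) %% p) (A *m x i) in
  let y' := [eta y with i |-> yi] in
  if @free F 'cV[F]_n (mkseq (fun m => residue (y' m)) i.+1) then
    LsfState k i.+1 x y' [eta alpha with i |-> k]
  else
    let a (m : 'I_i) : {poly K} :=
      val (@coord F 'cV[F]_n i [tuple residue (y' j) | j < i] m (residue yi)
           : {poly %/ p}) in
    let xi := x i - \sum_(m < i) (p ^+ (k - alpha m) * a m) *: x m in
    let x' m := if (i <= m < n.-1)%N then x m.+1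
                else if m == n.-1 then xi else x m in
    LsfState k i x' y' alpha.

Definition lsf_body (st : lsf_state) : lsf_state :=
  let: LsfState k i x y alpha := iter (n - st_i st) lsf_step st in
  LsfState k.+1 i x y alpha.

(* The state reached after j passes through the body of the while loop, the   *)
(* guard being disregarded.                                                   *)
Definition lsf_iter (j : nat) : lsf_state := iter j lsf_body lsf_init.

Definition lsf_terminates_after (N : nat) : Prop :=
  (forall j, (j < N)%N -> (st_i (lsf_iter j) < n)%N) /\
  ~~ (st_i (lsf_iter N) < n)%N.

Definition lsf_V (st : lsf_state) : 'M[{poly K}]_n :=
  \matrix_(r < n, c < n) st_x st c r 0.

End LocalSmithForm.

(* Main.v *)
Require Import Defs.
From mathcomp Require Import all_boot all_order all_algebra all_field.

(* Suppose t steps of pass k remain. The accepted columns satisfy             *)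
(* A x_m = p^(alpha_m) q_m with the q_m independent modulo p; those still to  *)
(* be examined satisfy p^k | A x_m, and the rejected ones p^(k+1) | A x_m,    *)
(* because the correction cancels the residue of A x_i / p^k. Each step is an *)
(* elementary column operation followed by a permutation, so the x_m keep     *)
(* spanning R^n. If a column is unaccepted at the start of pass k, then       *)
(* A V = Q D with p^k | det D, hence p^k | det A and k <= mu. Once all        *)
(* columns are accepted, E = [q_1, ..., q_n] is invertible modulo p.          *)

Local Open Scope ring_scope.

Set Implicit Arguments.
Unset Strict Implicit.
Unset Printing Implicit Defensive.

Import GRing.Theory.

(** All conclusions are carried by one loop invariant, [lsf_inv], preserved by [lsf_inv_step].
    Acceptance only changes bookkeeping. Rejection lifts a relation modulo p among the q_m to R;
    this gives A x_i one more factor p and raises its degree bound by at most s ([size_correction]).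
    An unaccepted column at pass k forces p^k to divide det A ([lsf_inv_dvd_det]), which bounds the
    passes by mu. At exit the exponents are the alpha_m, and [det_map_neq0] turns independence
    modulo p into p not dividing det E. *)

(** * The residue field R/pR *)

Section MonicIrreducible.

Variables (K : fieldType) (p : {poly K}) (p_mi : monic_irreducible_poly p).
Local Notation F := {poly %/ p with p_mi}.

(** Typed as a morphism into the field, so that the [map_mx] and determinant lemmas apply to
    [residue]. *)
Definition residue_field_morph : {rmorphism {poly K} -> F} := in_qpoly p.

Definition qfpoly_val (a : F) : {poly K} := val (a : {poly %/ p}).

Lemma qfpoly_val_inj : injective qfpoly_val.
Proof. by move=> a b /(@val_inj _ _ {poly %/ p}). Qed.

Lemma val_residue_field_morph g : qfpoly_val (residue_field_morph g) = g %% p.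
Proof. by rewrite /qfpoly_val /= (mk_monicE p_mi) Pdiv.IdomainMonic.modpE ?p_mi. Qed.

Lemma residue_field_morph_eq0 g : (residue_field_morph g == 0) = (p %| g).
Proof.
by rewrite /dvdp -val_residue_field_morph -(inj_eq qfpoly_val_inj).
Qed.

Lemma residue_field_morph_mod g : residue_field_morph (g %% p) = residue_field_morph g.
Proof.
by apply: qfpoly_val_inj; rewrite !val_residue_field_morph modp_id.
Qed.

Lemma size_qfpoly (a : F) : (size (qfpoly_val a) < size p)%N.
Proof. by rewrite -[in ltnRHS](mk_monicE p_mi); apply: size_mk_monic. Qed.

Lemma residue_field_morph_val (a : F) : residue_field_morph (qfpoly_val a) = a.
Proof.
by apply: qfpoly_val_inj; rewrite val_residue_field_morph modp_small ?size_qfpoly.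
Qed.

Lemma monic_irreducible_size_gt1 : (1 < size p)%N.
Proof. by case: p_mi.1. Qed.

Lemma monic_irreducible_neq0 : p != 0.
Proof. by rewrite monic_neq0 ?p_mi. Qed.

Lemma dvdp_exp_coprime_leq (f : {poly K}) k mu :
  ~~ (p %| f) -> p ^+ k %| f * p ^+ mu -> (k <= mu)%N.
Proof.
move=> pNf pk; rewrite leqNgt; apply: contra pNf => lt_mu_k.
have: p ^+ mu.+1 %| f * p ^+ mu by apply: dvdp_trans pk; apply: dvdp_exp2l.
by rewrite exprS dvdp_mul2r // expf_neq0 // monic_irreducible_neq0.
Qed.

End MonicIrreducible.

(** * Linear independence of initial segments of a sequence *)

Section FreeMkseq.

Variables (K : fieldType) (vT : vectType K).
Implicit Type f : nat -> vT.

Lemma free_mkseqS f i :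
  free (mkseq f i.+1) = (f i \notin <<mkseq f i>>%VS) && free (mkseq f i).
Proof.
rewrite mkseqS -free_cons; apply: perm_free.
by rewrite -cats1 perm_catC.
Qed.

Lemma mkseq_tuple f i : [tuple f j | j < i] = mkseq f i :> seq vT.
Proof. by rewrite /= /mkseq -val_enum_ord -map_comp. Qed.

Lemma coord_mkseq f i v : v \in <<mkseq f i>>%VS ->
  v = \sum_(m < i) coord [tuple f j | j < i] m v *: f m.
Proof.
rewrite -mkseq_tuple => /coord_span {1}->; apply: eq_bigr => m _.
by rewrite -tnth_nth tnth_mktuple.
Qed.

End FreeMkseq.

(** A vanishing determinant gives a nonzero row vector killing the transposed image matrix, that is,
    a relation among the images of the columns. *)
Lemma det_map_neq0 (R : comNzRingType) (L : fieldType) (g : {rmorphism R -> L}) n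
    (q : nat -> 'cV[R]_n) :
  free (mkseq (fun m => map_mx g (q m)) n) ->
  g (\det (\matrix_(r < n, c < n) q c r 0)) != 0.
Proof.
rewrite -mkseq_tuple => /freeP free_q; rewrite -det_map_mx -det_tr.
apply/negP => /det0P [v v_neq0 vE].
case/negP: v_neq0; apply/eqP/rowP => c; rewrite mxE.
apply: (free_q (v 0)); apply/colP => r; rewrite summxE mxE.
have /rowP/(_ r) := vE; rewrite !mxE => {2}<-.
by apply: eq_bigr => m _; rewrite -tnth_nth tnth_mktuple !mxE.
Qed.

(** * Spans of columns over a commutative ring *)

Section ColumnSpan.

Variables (R : comNzRingType) (n k : nat) (V : 'M[R]_(n, k)).

Definition col_span (v : 'cV[R]_n) : Prop := exists w, v = V *m w.

Lemma col_span_col c : col_span (col c V).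
Proof. by exists (delta_mx c 0); rewrite colE. Qed.

Lemma col_spanD v w : col_span v -> col_span w -> col_span (v + w).
Proof. by move=> [a ->] [b ->]; exists (a + b); rewrite mulmxDr. Qed.

Lemma col_spanZ a v : col_span v -> col_span (a *: v).
Proof. by move=> [b ->]; exists (a *: b); rewrite scalemxAr. Qed.

Lemma col_span_sum (I : finType) (G : I -> 'cV[R]_n) :
  (forall j, col_span (G j)) -> col_span (\sum_j G j).
Proof.
move=> GV; apply: big_ind => //; last exact: col_spanD.
by exists 0; rewrite mulmx0.
Qed.

Lemma col_span_mulmx l (U : 'M[R]_(n, l)) :
  (forall c, col_span (col c U)) -> exists T, U = V *m T.
Proof.
move=> /fin_all_exists [w wE]; exists (\matrix_(r, c) w c r 0).
apply/matrixP => r c; have /colP/(_ r) := wE c; rewrite !mxE => ->.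
by apply: eq_bigr => j _; rewrite mxE.
Qed.

End ColumnSpan.

(** * The loop invariant and its preservation by one step *)

Section Invariant.

Variables (K : fieldType) (n : nat) (A : 'M[{poly K}]_n).
Variables (p : {poly K}) (p_mi : monic_irreducible_poly p).
Local Notation F := {poly %/ p with p_mi}.
Local Notation phi := (residue_field_morph p_mi).
Local Notation s := (size p).-1.

(* The power of p known to divide A x_m when t steps of the current pass      *)
(* remain: a rejected column, moved to the end, has gained one factor p.      *)
Definition level (t : nat) (st : lsf_state K n) (m : nat) : nat :=
  if (m < st_i st)%N then st_alpha st m
  else if (m < st_i st + t)%N then st_k st else (st_k st).+1.

(** The quotients [q] are not part of the state: the algorithm keeps only remainders [st_y], with
    the same residues. A right inverse [W] says that the columns span R^n, which is easier to carry
    through rotations than a determinant. *)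
Record lsf_inv (t : nat) (st : lsf_state K n) (q : nat -> 'cV[{poly K}]_n) :
    Prop := LsfInv {
  inv_room : (st_i st + t <= n)%N;
  inv_alpha_le : forall m, (m < st_i st)%N -> (st_alpha st m <= st_k st)%N;
  inv_alpha_mono : forall m, (m.+1 < st_i st)%N ->
    (st_alpha st m <= st_alpha st m.+1)%N;
  inv_quot : forall m, (m < n)%N -> A *m st_x st m = p ^+ level t st m *: q m;
  inv_residue : forall m, (m < st_i st)%N ->
    residue p_mi (q m) = residue p_mi (st_y st m);
  inv_free : @free F 'cV[F]_n (mkseq (fun m => residue p_mi (q m)) (st_i st));
  inv_size : forall m r, (m < n)%N ->
    (size (st_x st m r 0%R) <= maxn (s * level t st m) 1)%N;
  inv_unit : exists W, lsf_V st *m W = 1%:M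
}.

Lemma residueE (v : 'cV[{poly K}]_n) : residue p_mi v = map_mx phi v.
Proof. by []. Qed.

Lemma residue_rem_quo (v q : 'cV[{poly K}]_n) k : v = p ^+ k *: q ->
  residue p_mi (map_mx (fun f => (f %/ p ^+ k) %% p) v) = residue p_mi q.
Proof.
move=> ->; rewrite !residueE; apply/colP => r; rewrite !mxE.
by rewrite residue_field_morph_mod mulKp // expf_neq0 // (monic_irreducible_neq0 p_mi).
Qed.

Lemma residue_eq0_quot (v : 'cV[{poly K}]_n) : residue p_mi v = 0 -> exists w, v = p *: w.
Proof.
move=> v0; exists (map_mx (fun f => f %/ p) v); apply/colP => r.
rewrite !mxE mulrC divpK // -(residue_field_morph_eq0 p_mi).
by have /colP/(_ r) := v0; rewrite residueE !mxE => ->.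
Qed.

Lemma residue_comb_eq0 i (q : nat -> 'cV[{poly K}]_n) (a : 'I_i -> F) :
  residue p_mi (q i) = \sum_(m < i) a m *: residue p_mi (q m) ->
  residue p_mi (q i - \sum_(m < i) qfpoly_val (a m) *: q m) = 0.
Proof.
rewrite !residueE map_mxB => ->; rewrite raddf_sum; apply/eqP.
rewrite subr_eq0; apply/eqP/eq_bigr => m _.
by rewrite /= map_mxZ residue_field_morph_val.
Qed.

Lemma col_lsf_V (st : lsf_state K n) c : col c (lsf_V st) = st_x st c.
Proof. by apply/colP => r; rewrite !mxE. Qed.

Lemma col_span_lsf_V (st : lsf_state K n) m : (m < n)%N -> col_span (lsf_V st) (st_x st m).
Proof.
by move=> lt_mn; have := col_span_col (lsf_V st) (Ordinal lt_mn); rewrite col_lsf_V.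
Qed.

(** If the new columns span the old ones, V = V' T, so T W is a right inverse of V'. *)
Lemma lsf_V_right_inverse (st st' : lsf_state K n) :
  (forall m, (m < n)%N -> col_span (lsf_V st') (st_x st m)) ->
  (exists W, lsf_V st *m W = 1%:M) -> exists W, lsf_V st' *m W = 1%:M.
Proof.
move=> sub [W VW]; have [c|T VE] := @col_span_mulmx _ _ _ (lsf_V st') _ (lsf_V st).
  by rewrite col_lsf_V; apply: sub.
by exists (T *m W); rewrite mulmxA -VE.
Qed.

Lemma size_correction k al (a x : {poly K}) :
  (al <= k)%N -> (size a < size p)%N -> (size x <= maxn (s * al) 1)%N ->
  (size ((p ^+ (k - al) * a) * x)%R <= s * k.+1)%N.
Proof.
move=> le_al_k lt_a le_x.
have s_gt0: (0 < s)%N by rewrite -subn1 subn_gt0 (monic_irreducible_size_gt1 p_mi).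
have sz_p: size p = s.+1 by rewrite prednK // (ltn_trans _ (monic_irreducible_size_gt1 p_mi)).
have le_a: (size a <= s)%N by rewrite -ltnS -sz_p.
apply: leq_trans (size_polyMleq _ _) _.
have le_pa: (size (p ^+ (k - al) * a)%R <= s * (k - al) + s)%N.
  apply: leq_trans (size_polyMleq _ _) _.
  have := size_poly_exp_leq p (k - al).
  by rewrite -[(_ + _).-1]subn1 leq_subLR addnA add1n => h; apply: leq_add.
have -> : (s * k.+1 = s * (k - al) + s + s * al)%N.
  by rewrite addnAC -mulnDr subnK // mulnS addnC.
(* For al = 0 the bound on x is 1, not s * al; the unit lost in the size of a product absorbs it. *)
case: al {le_al_k} le_x le_pa => [|al] le_x le_pa.
  rewrite muln0 max0n in le_x.
  by rewrite muln0 addn0 -[(_ + _).-1]subn1 leq_subLR addnC; apply: leq_add.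
apply: leq_trans (leq_pred _) _; apply: leq_add => //.
by rewrite (maxn_idPl _) // in le_x; rewrite muln_gt0 s_gt0.
Qed.

Lemma lsf_inv_step t st q : lsf_inv t.+1 st q ->
  exists q', lsf_inv t (lsf_step A p_mi st) q'.
Proof.
case: st => k i x y alpha [] /=; rewrite addnS => room al_le al_mono quot res fr sz unit.
have lt_in : (i < n)%N by apply: leq_ltn_trans room; apply: leq_addr.
have level_i : level t.+1 (LsfState k i x y alpha) i = k.
  by rewrite /level /= ltnn addnS ltnS leq_addr.
set yi := map_mx _ (A *m x i).
have res_yi : residue p_mi yi = residue p_mi (q i).
  by apply: residue_rem_quo; rewrite quot // level_i.
have res_y' m : (m < i.+1)%N -> residue p_mi ([eta y with i |-> yi] m) = residue p_mi (q m).
  by rewrite ltnS leq_eqVlt /=; case: eqP => [->|_ /= /res].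
set f := mkseq _ _; have -> : f = mkseq (fun m => residue p_mi (q m)) i.+1.
  by apply/eq_in_map => m; rewrite mem_iota add0n => /res_y'.
case: ifPn => [free_q|].
  exists q.
  (* Column i had level k and now gets alpha_i = k, so acceptance changes no level. *)
  have levelE m : level t (LsfState k i.+1 x [eta y with i |-> yi]
      [eta alpha with i |-> k]) m = level t.+1 (LsfState k i x y alpha) m.
    rewrite /level /= ltnS addSn addnS leq_eqVlt.
    case: (eqVneq m i) => [->|_] /=; first by rewrite ltnn ltnS leq_addr.
    by [].
  split=> //=; rewrite ?addSn //.
  - by move=> m; rewrite ltnS leq_eqVlt; case: eqP => //= _ /al_le.
  - move=> m; rewrite !ltnS => lt_mi; rewrite (ltn_eqF lt_mi).
    case: eqP => [_|/eqP ne]; first exact: al_le.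
    by apply: al_mono; rewrite ltn_neqAle ne.
  - by move=> m lt_mn; rewrite levelE quot.
  - by move=> m /res_y' /= ->.
  - by move=> m r lt_mn; rewrite levelE sz.
set tup := [tuple residue p_mi (q j) | j < i].
have tupE : [tuple residue p_mi ([eta y with i |-> yi] j) | j < i] = tup.
  by apply: eq_from_tnth => j; rewrite !tnth_mktuple res_y' // ltnS ltnW.
(* Since the accepted residues are independent, a failed test puts that of q_i in their span. *)
rewrite free_mkseqS fr andbT negbK => /coord_mkseq q_i.
rewrite tupE res_yi.
(* Here q_i - sum a_m q_m = p w; [w] is the quotient of the corrected column at level k+1. *)
have [w wE] := residue_eq0_quot (residue_comb_eq0 q_i).
pose a m : {poly K} := qfpoly_val (coord tup m (residue p_mi (q i))).
set xi := x i - _.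
have n_gt0 : (0 < n)%N by apply: leq_ltn_trans lt_in.
have i_le : (i <= n.-1)%N by rewrite -ltnS prednK.
exists (fun m => if (i <= m < n.-1)%N then q m.+1
                 else if m == n.-1 then w else q m).
set x' := (fun m => if _ then x m.+1 else _).
set st' := LsfState _ _ _ _ _.
have x'_lt m : (m < i)%N -> x' m = x m.
  by move=> lt_mi; rewrite /x' leqNgt lt_mi /= (ltn_eqF (leq_trans lt_mi i_le)).
have x'_mid m : (i <= m < n.-1)%N -> x' m = x m.+1 by rewrite /x' => ->.
have x'_last : x' n.-1 = xi by rewrite /x' ltnn andbF eqxx.
have level_lt m : (m < i)%N -> level t st' m = alpha m by rewrite /level /= => ->.
have level_lt0 m : (m < i)%N -> level t.+1 (LsfState k i x y alpha) m = alpha m.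
  by rewrite /level /= => ->.
have level_mid m : (i <= m < n.-1)%N ->
    level t st' m = level t.+1 (LsfState k i x y alpha) m.+1.
  move=> /andP[le_im _]; rewrite /level /= addnS ltnS.
  by rewrite !ltnNge le_im (leq_trans le_im).
(* The last place lies outside the columns still to examine, because i + t + 1 <= n. *)
have level_last : level t st' n.-1 = k.+1.
  rewrite /level /= ltnNge i_le /= ltnNge.
  by rewrite -ltnS prednK // room.
have lt_i_n m : (m < i)%N -> (m < n)%N by move=> lt_mi; apply: ltn_trans lt_in.
have mid_n m : (i <= m < n.-1)%N -> (m.+1 < n)%N.
  by case/andP=> _; rewrite -ltnS prednK.
have cases m : (m < n)%N -> [\/ (m < i)%N, (i <= m < n.-1)%N | m = n.-1].
  move=> lt_mn; case: (ltnP m i) => [lt_mi|le_im]; first by constructor 1.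
  have: (m <= n.-1)%N by rewrite -ltnS prednK.
  by rewrite leq_eqVlt => /orP[/eqP->|lt]; [constructor 3|constructor 2].
split=> //=.
- exact: ltnW.
- move=> m /cases [lt_mi|mid|->].
  + rewrite x'_lt // level_lt // quot ?lt_i_n // level_lt0 //.
    by rewrite leqNgt lt_mi /= (ltn_eqF (leq_trans lt_mi i_le)).
  + by rewrite x'_mid // level_mid // quot ?mid // mid_n.
  + rewrite x'_last level_last ltnn andbF eqxx exprSr -scalerA -wE.
    rewrite mulmxBr quot // level_i scalerBr; congr (_ - _).
    (* Termwise, p^(k - alpha_j) a_j p^(alpha_j) q_j = p^k a_j q_j. *)
    rewrite mulmx_sumr scaler_sumr; apply: eq_bigr => j _.
    rewrite -scalemxAr quot ?lt_i_n // level_lt0 // !scalerA.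
    by rewrite mulrAC -exprD subnK // al_le.
- move=> m lt_mi; rewrite leqNgt lt_mi /= (ltn_eqF (leq_trans lt_mi i_le)).
  by rewrite (ltn_eqF lt_mi) res.
- rewrite (_ : mkseq _ i = mkseq (fun m => residue p_mi (q m)) i) //.
  apply/eq_in_map => m; rewrite mem_iota add0n => /= lt_mi.
  by rewrite leqNgt lt_mi /= (ltn_eqF (leq_trans lt_mi i_le)).
- move=> m r /cases [lt_mi|mid|->].
  + by rewrite x'_lt // level_lt // -level_lt0 // sz // lt_i_n.
  + by rewrite x'_mid // level_mid // sz // mid_n.
  + rewrite x'_last level_last leq_max; apply/orP; left.
    rewrite !mxE; apply: leq_trans (size_polyD _ _) _.
    rewrite size_polyN geq_max; apply/andP; split.
      apply: leq_trans (sz _ r lt_in) _; rewrite level_i.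
      have s_gt0: (0 < s)%N by rewrite -subn1 subn_gt0 (monic_irreducible_size_gt1 p_mi).
      by rewrite geq_max muln_gt0 s_gt0 leq_mul2l leqnSn orbT.
    rewrite summxE; apply: leq_trans (size_sum _ _ _) _.
    apply/bigmax_leqP => j _; rewrite mxE; apply: size_correction.
    * exact: al_le.
    * exact: size_qfpoly.
    * by rewrite -level_lt0 // sz // lt_i_n.
- apply: lsf_V_right_inverse unit => m lt_mn.
  have span' j : (j < n)%N -> col_span (lsf_V st') (x' j) by apply: (@col_span_lsf_V st').
  case: (ltngtP m i) => [lt_mi|lt_im|->].
  + by rewrite /= -x'_lt //; apply: span'.
  + have mid : (i <= m.-1 < n.-1)%N.
      by case: m lt_mn lt_im => //= m lt_mn; rewrite ltnS => ->; rewrite -ltnS prednK.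
    rewrite /= -(prednK (leq_ltn_trans (leq0n i) lt_im)) -x'_mid //.
    by apply: span'; apply: leq_ltn_trans lt_mn; apply: leq_pred.
  (* The old x_i is recovered by adding back the correction, whose columns are untouched by the
     rotation. *)
  + have -> : st_x (LsfState k i x y alpha) i =
        x' n.-1 + \sum_(m < i) (p ^+ (k - alpha m) * a m) *: x' m.
      rewrite x'_last /= /xi -{1}[x i](subrK (\sum_(m < i) (p ^+ (k - alpha m) * a m) *: x m)).
      by congr (_ + _); apply: eq_bigr => j _; rewrite x'_lt.
    apply: col_spanD; first by apply: span'; rewrite prednK.
    apply: col_span_sum => j; apply: col_spanZ; apply: span'.
    exact: lt_i_n.
Qed.

(** * Complete passes of the loop *)

Lemma st_k_lsf_step st : st_k (lsf_step A p_mi st) = st_k st.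
Proof. by case: st => k i x y alpha /=; case: ifP. Qed.

Lemma st_k_iter_lsf_step t st : st_k (iter t (lsf_step A p_mi) st) = st_k st.
Proof. by elim: t => //= t <-; rewrite st_k_lsf_step. Qed.

Lemma lsf_inv_iter_step t st q : lsf_inv t st q ->
  exists q', lsf_inv 0 (iter t (lsf_step A p_mi) st) q'.
Proof.
elim: t st q => [|t IH] st q inv; first by exists q.
by have [q' /IH] := lsf_inv_step inv; rewrite iterSr.
Qed.

(** At the end of pass k every unaccepted column has level k+1, exactly what the start of pass k+1
    requires. *)
Lemma lsf_inv_next_pass k i x y alpha q :
  lsf_inv 0 (LsfState k i x y alpha) q ->
  lsf_inv (n - i) (LsfState k.+1 i x y alpha) q.
Proof.
case=> /=; rewrite addn0 => room al_le al_mono quot res fr sz unit.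
have levelE m : (m < n)%N -> level (n - i) (LsfState k.+1 i x y alpha) m =
    level 0 (LsfState k i x y alpha) m.
  by move=> lt_mn; rewrite /level /= subnKC // lt_mn addn0; case: (m < i)%N.
split=> //=.
- by rewrite subnKC.
- by move=> m /al_le; apply: leqW.
- by move=> m lt_mn; rewrite levelE // quot.
- by move=> m r lt_mn; rewrite levelE // sz.
Qed.

Lemma lsf_inv_init : lsf_inv n (lsf_init K n) (fun m => A *m st_x (lsf_init K n) m).
Proof.
have level0 m : (m < n)%N -> level n (lsf_init K n) m = 0%N.
  by rewrite /level /= add0n => ->.
split=> //=.
- by move=> m lt_mn; rewrite level0 // expr0 scale1r.
- by rewrite nil_free.
- move=> m r lt_mn; rewrite level0 // muln0 max0n mxE.
  by case: eqP => _; rewrite ?size_poly1 ?size_poly0.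
- exists 1%:M; rewrite mulmx1; apply/matrixP => r c.
  by rewrite !mxE.
Qed.

Lemma lsf_inv_lsf_iter j :
  st_k (lsf_iter A p_mi j) = j /\
  exists q, lsf_inv (n - st_i (lsf_iter A p_mi j)) (lsf_iter A p_mi j) q.
Proof.
elim: j => [|j [kE [q]]].
  by split=> //; rewrite subn0; eexists; apply: lsf_inv_init.
rewrite /lsf_iter iterS -/(lsf_iter A p_mi j) /lsf_body.
move: (lsf_iter A p_mi j) kE => st kE /lsf_inv_iter_step [q'].
have := st_k_iter_lsf_step (n - st_i st) st.
case: (iter _ _ _) => k i x y alpha /= -> /lsf_inv_next_pass inv.
by split; [rewrite kE | exists q'].
Qed.

(** * What the invariant says about A V, det V and det A *)

Lemma lsf_inv_factor t st q : lsf_inv t st q ->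
  A *m lsf_V st =
  (\matrix_(r < n, c < n) q c r 0) *m diag_mx (\row_(c < n) p ^+ level t st c).
Proof.
move=> inv; apply/matrixP => r c; rewrite mul_mx_diag !mxE.
have /colP/(_ r) := inv_quot inv (ltn_ord c); rewrite !mxE mulrC => <-.
by apply: eq_bigr => j _; rewrite !mxE.
Qed.

Lemma lsf_inv_det_unit t st q : lsf_inv t st q -> \det (lsf_V st) \is a GRing.unit.
Proof.
by move=> inv; have [W /mulmx1_unit[]] := inv_unit inv; rewrite unitmxE.
Qed.

Lemma lsf_inv_unimodular t st q : lsf_inv t st q -> unimodular (lsf_V st).
Proof.
move=> /lsf_inv_det_unit; rewrite poly_unitE unitfE => /andP[/eqP sz c_neq0].
by exists (\det (lsf_V st))`_0 => //; apply: size1_polyC; rewrite sz.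
Qed.

(** The unaccepted column i contributes the diagonal entry p^k to A V = Q D, and det V is a unit. *)
Lemma lsf_inv_dvd_det st q : lsf_inv (n - st_i st) st q -> (st_i st < n)%N ->
  p ^+ st_k st %| \det A.
Proof.
move=> inv lt_in; rewrite -[\det A](mulrK (lsf_inv_det_unit inv)) -det_mulmx.
rewrite (lsf_inv_factor inv) det_mulmx det_diag (bigD1 (Ordinal lt_in)) //= mxE.
rewrite /level /= ltnn subnKC ?lt_in 1?ltnW //.
by apply/dvdp_mulr/dvdp_mull/dvdp_mulr.
Qed.

Lemma vdeg_leq (v : 'cV[{poly K}]_n) d :
  (forall r, (size (v r 0%R) <= maxn d 1)%N) -> (vdeg v <= maxn (d - 1) 0)%N.
Proof.
move=> le_v; apply/bigmax_leqP => r _; rewrite maxn0.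
have := le_v r; case: d {le_v} => [|d]; last by rewrite subn1 /=; case: (size _).
by case: (size _) => [|[]].
Qed.

Lemma lsf_inv_leq_mu st q f mu : ~~ (p %| f) -> \det A = f * p ^+ mu ->
  lsf_inv (n - st_i st) st q -> (st_i st < n)%N -> (st_k st <= mu)%N.
Proof.
move=> pNf det_eq inv /(lsf_inv_dvd_det inv); rewrite det_eq.
exact: dvdp_exp_coprime_leq.
Qed.

End Invariant.

Theorem mainTheorem1 (K : fieldType) (n : nat) (A : 'M[{poly K}]_n)
    (p f : {poly K}) (p_mi : monic_irreducible_poly p) (mu : nat)
    (det_neq0 : \det A != 0) (p_dvd : p %| \det A) (mu_ge1 : (1 <= mu)%N)
    (det_eq : \det A = f * p ^+ mu) (p_ndvd : ~~ (p %| f)) :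
  exists N : nat,
    [/\ lsf_terminates_after A p_mi N,
        forall j : nat, (j < N)%N -> (st_k (lsf_iter A p_mi j) <= mu)%N &
        let st := lsf_iter A p_mi N in
        let V := lsf_V st in
        let alpha := st_alpha st in
        [/\ unimodular V,
            forall m : nat, (m.+1 < n)%N -> (alpha m <= alpha m.+1)%N,
            exists E : 'M[{poly K}]_n,
              A *m V = E *m diag_mx (\row_(m < n) p ^+ alpha m)
              /\ ~~ (p %| \det E) &
            forall m : 'I_n,
              (vdeg (col m V) <= maxn ((size p).-1 * alpha m - 1) 0)%N]].
Proof.
have k_le j : (st_i (lsf_iter A p_mi j) < n)%N -> (j <= mu)%N.
  have [kE [q inv]] := lsf_inv_lsf_iter A p_mi j.
  by move=> /(lsf_inv_leq_mu p_ndvd det_eq inv); rewrite kE.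
(* The guard fails by pass mu + 1; the least such count is taken as [N], so that it holds at every
   earlier pass. *)
have terminates : exists j, (n <= st_i (lsf_iter A p_mi j))%N.
  by exists mu.+1; rewrite leqNgt; apply/negP => /k_le; rewrite ltnn.
case: (ex_minnP terminates) => N le_ni N_min; exists N.
have before j : (j < N)%N -> (st_i (lsf_iter A p_mi j) < n)%N.
  by rewrite !ltnNge; apply: contra => /N_min.
split.
- by split=> //; rewrite -leqNgt.
- by move=> j lt_jN; have [-> _] := lsf_inv_lsf_iter A p_mi j; apply/k_le/before.
have [_ [q inv]] := lsf_inv_lsf_iter A p_mi N.
move: (lsf_iter A p_mi N) le_ni inv => st le_ni inv /=.
have iE : st_i st = n.
  by apply/eqP; rewrite eqn_leq le_ni andbT (leq_trans _ (inv_room inv)) ?leq_addr.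
have levelE m : (m < n)%N -> level (n - st_i st) st m = st_alpha st m.
  by rewrite /level iE => ->.
split.
- exact: lsf_inv_unimodular inv.
- by move=> m lt_mn; apply: (inv_alpha_mono inv); rewrite iE.
(* E has the final quotients q_m as columns. *)
- exists (\matrix_(r < n, c < n) q c r 0); split.
    rewrite (lsf_inv_factor inv); congr (_ *m diag_mx _).
    by apply/rowP => c; rewrite !mxE levelE.
  rewrite -(residue_field_morph_eq0 p_mi); apply: det_map_neq0.
  by have := inv_free inv; rewrite iE.
- move=> m; apply: vdeg_leq => r; rewrite -levelE // mxE mxE.
  exact: (inv_size inv).
Qed.
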